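(* Let $X$ and $Y$ be random variables taking values in $\mathbb{R}$, with quantile functions $Q_X$ and $Q_Y$, and such that $-\infty<E[X]<E[Y]<+\infty$. Then $$f_{Z^L}(u)=\frac{Q_Y(u)-Q_X(u)}{E[Y]-E[X]},\qquad 0<u<1,$$ is the probability density function of an absolutely continuous random variable $Z^L$ taking values in $(0,1)$ if, and only if, $X\leq_{st}Y$.
   Context: For a random variable $X$ with distribution function $F_X(x)=P(X\le x)$, the quantile function is $Q_X(u)=\inf\{x\in\mathbb{R}:F_X(x)\ge u\}$, $0<u<1$. $X\leq_{st}Y$ (usual stochastic order) means $P(X>t)\le P(Y>t)$ for all $t\in\mathbb{R}$. *)

(* Defs.v *)
From HB Require Import structures.
From mathcomp Require Import all_boot all_order all_algebra.
From mathcomp Require Import all_classical all_reals all_analysis.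

Set Implicit Arguments.
Unset Strict Implicit.
Unset Printing Implicit Defensive.

Import Order.TTheory GRing.Theory Num.Theory.
Import numFieldNormedType.Exports.

Local Open Scope classical_set_scope.
Local Open Scope ring_scope.

(* Meaningful for 0 < u < 1 only: otherwise the set may be empty or unbounded
   below, and the real-valued [inf] then returns a default value. *)
Definition quantile {d : measure_display} {T : measurableType d}
    {R : realType} {P : probability T R} (X : {RV P >-> R}) (u : R) : R :=
  inf [set x : R | (u%:E <= cdf X x)%E].

(* [X] and [Y] may live on different probability spaces. *)
Definition st_le {d1 d2 : measure_display} {T1 : measurableType d1}
    {T2 : measurableType d2} {R : realType} {P : probability T1 R}
    {Q : probability T2 R} (X : {RV P >-> R}) (Y : {RV Q >-> R}) : Prop :=
  forall t : R, (ccdf X t <= ccdf Y t)%E.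

Definition is_pdf {d : measure_display} {T : measurableType d}
    {R : realType} {P : probability T R} (Z : {RV P >-> R})
    (f : R -> R) : Prop :=
  [/\ measurable_fun [set: R] f,
      forall x, 0 <= f x &
      forall A : set R, measurable A ->
        distribution P Z A = (\int[lebesgue_measure]_(x in A) (f x)%:E)%E].

(* [f] is only relevant on ]0, 1[: the density on the real line is its
   extension by 0, [f \_ `]0, 1[]. *)
Definition is_pdf_of_ac_rv_in01 {R : realType} (f : R -> R) : Prop :=
  exists (d : measure_display) (T : measurableType d) (P : probability T R)
    (Z : {RV P >-> R}),
    [/\ forall w : T, 0 < Z w < 1,
        distribution P Z `<< @lebesgue_measure R &
        is_pdf Z (f \_ `]0, 1[)].

Definition f_ZL {d1 d2 : measure_display} {T1 : measurableType d1}
    {T2 : measurableType d2} {R : realType} {P : probability T1 R}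
    {Q : probability T2 R} (X : {RV P >-> R}) (Y : {RV Q >-> R}) (u : R) : R :=
  (quantile Y u - quantile X u) / (fine 'E_Q[Y] - fine 'E_P[X]).

(* Main.v *)
Require Import Defs.
From HB Require Import structures.
From mathcomp Require Import all_boot all_order all_algebra.
From mathcomp Require Import all_classical all_reals all_analysis.
From mathcomp Require Import measurable_realfun.

(** Two facts about the quantile function [quantile X] on ]0, 1[ carry the
    proof.

    The first is the Galois connection [quantile_le]: for 0 < u < 1,
    Q_X(u) <= x iff u <= F_X(x). It comes from the right continuity of the
    cumulative distribution function F_X, which makes the infimum defining
    Q_X(u) a minimum. It turns the order of the distribution functions into
    the reverse order of the quantile functions, so that X <=_st Y holds iff
    Q_X <= Q_Y on ]0, 1[ ([st_leP]), that is, iff the candidate density is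
    nonnegative: its denominator E[Y] - E[X] is positive.

    The second is inverse transform sampling: if U is uniform on ]0, 1[, then
    Q_X(U) has the law of X, because by the Galois connection both laws give
    the same mass 1 - F_X(x) to each ray ]x, +oo[. Hence the integral of Q_X
    over ]0, 1[ is E[X] ([integral_quantile]), and the candidate density
    always has integral 1.

    A density is nonnegative, which gives one direction. Conversely, a
    nonnegative measurable function on ]0, 1[ with integral 1 is the density of
    a random variable with values in ]0, 1[ ([pdf_in01_exists]). *)

Set Implicit Arguments.
Unset Strict Implicit.
Unset Printing Implicit Defensive.

Import Order.TTheory GRing.Theory Num.Theory.
Import numFieldNormedType.Exports.

Local Open Scope classical_set_scope.
Local Open Scope ring_scope.

(** * The quantile function as an adjoint of the distribution function *)

Section quantile_cdf.
Context {d : measure_display} {T : measurableType d} {R : realType}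
  {P : probability T R} (X : {RV P >-> R}).

(** Right continuity of the distribution function, in the form that makes the
    infimum in the definition of the quantile a minimum. *)
Lemma cdf_lt_near_right (x u : R) : (cdf X x < u%:E)%E ->
  exists2 y, x < y & (cdf X y < u%:E)%E.
Proof.
rewrite -[cdf X x]fineK ?fin_num_measure// lte_fin => Fxu.
have Fx : fine (cdf X y) @[y --> x^'+] --> fine (cdf X x).
  apply: fine_cvg; rewrite fineK ?fin_num_measure//.
  exact: cdf_right_continuous.
have [y [xy Fyu]] : exists y, x < y /\ fine (cdf X y) < u.
  near x^'+ => y; exists y; split; first by near: y; exact: nbhs_right_gt.
  by near: y; exact: (cvgr_lt _ Fx).
by exists y => //; rewrite -[cdf X y]fineK ?fin_num_measure// lte_fin.
Unshelve. all: by end_near. Qed.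

Lemma quantile_set_nonempty (u : R) : u < 1 ->
  [set x : R | (u%:E <= cdf X x)%E] !=set0.
Proof.
move=> u1; have /fine_cvg/= F1 := cvg_cdfy1 X.
near (pinfty_nbhs R) => x; exists x => /=.
rewrite -[cdf X x]fineK ?fin_num_measure// lee_fin ltW//.
by near: x; exact: (cvgr_gt _ F1).
Unshelve. all: by end_near. Qed.

Lemma quantile_set_lbounded (u : R) : 0 < u ->
  has_lbound [set x : R | (u%:E <= cdf X x)%E].
Proof.
move=> u0; have /fine_cvg/= F0 := cvg_cdfNy0 X.
near (ninfty_nbhs R) => x; exists x => y /= uFy.
rewrite leNgt; apply/negP => yx.
have : (cdf X x < u%:E)%E.
  rewrite -[cdf X x]fineK ?fin_num_measure// lte_fin.
  by near: x; exact: (cvgr_lt _ F0).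
by apply/negP; rewrite -leNgt (le_trans uFy)// cdf_nondecreasing// ltW.
Unshelve. all: by end_near. Qed.

(** If F_X(x) < u, then still F_X(y) < u for some y > x, so y is a lower bound
    of the set of which Q_X(u) is the infimum, and Q_X(u) >= y > x. *)
Lemma quantile_le (u x : R) : 0 < u < 1 ->
  (quantile X u <= x) = (u%:E <= cdf X x)%E.
Proof.
move=> /andP[u0 u1]; apply/idP/idP => [qx|ux]; last first.
  exact: (ge_inf (quantile_set_lbounded u0)).
rewrite leNgt; apply/negP => /cdf_lt_near_right[y xy Fyu].
have : y <= quantile X u.
  apply: lb_le_inf; first exact: quantile_set_nonempty.
  move=> z /= uFz; rewrite leNgt; apply/negP => zy.
  have := lt_le_trans Fyu uFz; apply/negP.
  by rewrite -leNgt cdf_nondecreasing// ltW.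
by apply/negP; rewrite -ltNge (le_lt_trans qx).
Qed.

Lemma quantile_gt (u x : R) : 0 < u < 1 ->
  (x < quantile X u) = (cdf X x < u%:E)%E.
Proof. by move=> u01; rewrite !ltNge quantile_le. Qed.

Lemma measurable_quantile : measurable_fun `](0:R), 1[ (quantile X).
Proof.
apply: (measurability (@RGenOInfty.G R)) => [|_ [_ [x ->] <-]].
  exact: RGenOInfty.measurableE.
(* By the Galois connection, the preimage of ]x, +oo[ is an interval. *)
rewrite (_ : _ `&` _ = `]0, 1[ `&` `]fine (cdf X x), +oo[).
  exact: measurableI.
apply/seteqP; split => u /=; rewrite !in_itv/= !andbT => -[u01];
  by rewrite quantile_gt// -[cdf X x]fineK ?fin_num_measure// lte_fin.
Qed.

End quantile_cdf.

(** * Inverse transform sampling *)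

(** The rays generate the Borel sets and are closed under intersection, and
    countably many of them cover the line. *)
Lemma eq_measure_rays (R : realType) (m1 m2 : {measure set R -> \bar R}) :
    (m1 setT < +oo)%E ->
    (forall x : R, m1 `]x, +oo[%classic = m2 `]x, +oo[%classic) ->
  forall A, measurable A -> m1 A = m2 A.
Proof.
move=> m1T m12; apply: (measure_unique (@RGenOInfty.G R)
  (fun n => `](- n%:R)%R, +oo[%classic)).
- exact: RGenOInfty.measurableE.
- move=> _ _ [x ->] [y ->]; exists (Num.max x y); apply/seteqP; split => z /=;
    rewrite !in_itv/= !andbT gt_max.
  + by move=> [-> ->].
  + by move/andP.
- by move=> n; exists (- n%:R).
- rewrite -subTset => x _; exists (Num.bound `|x|) => //=.
  rewrite in_itv/= andbT ltrNl (le_lt_trans (ler_norm _))// normrN.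
  exact: archi_boundP.
- by move=> _ [x ->]; exact: m12.
- by move=> n; apply: le_lt_trans m1T; apply: le_measure; rewrite ?inE.
Qed.

Section quantile_transform.
Context {d : measure_display} {T : measurableType d} {R : realType}
  {P : probability T R} (X : {RV P >-> R}).
Local Notation mu := (@lebesgue_measure R).

Lemma lebesgue_measure_setI01 (v : R) : 0 <= v <= 1 ->
  mu (`]v, +oo[ `&` `]0%R, 1%R[) = (1 - v)%:E.
Proof.
move=> /andP[v0 v1].
rewrite (_ : _ `&` _ = `]v, 1[%classic).
  rewrite lebesgue_measure_itv/= lte_fin; case: ltP => // v1'.
  by rewrite (le_anti (_ : v <= 1 <= v)) ?subrr// v1.
apply/seteqP; split => u /=; rewrite !in_itv/= andbT.
  by move=> [-> /andP[_ ->]].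
by move=> /andP[vu ->]; rewrite vu (le_lt_trans v0 vu).
Qed.

(** Change of variables: the law of the quantile function under the uniform
    distribution is the law of [X]. The quantile function is cut off outside
    ]0, 1[, where the infimum may be a default value. *)
Lemma ge0_integral_quantile (h : R -> \bar R) :
    measurable_fun setT h -> (forall x, 0 <= h x)%E ->
  (\int[mu]_(u in `]0%R, 1%R[) h (quantile X u) = \int[P]_w h (X w))%E.
Proof.
move=> mh h0.
pose q : R -> R := quantile X \_ `]0, 1[.
have mq : measurable_fun [set: R] q.
  exact: (measurable_restrictT (quantile X) (measurable_itv `](0:R), 1[)).1
    (measurable_quantile X).
pose U := uniform_prob (@ltr01 R).
have UE f : measurable_fun setT f -> (forall x, 0 <= f x)%E ->
    (\int[U]_x f x = \int[mu]_(x in `]0%R, 1%R[) f x)%E.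
  move=> mf f0; rewrite integral_uniform// subr0 invr1 mul1e.
  by rewrite integral_itv_bndoo//; exact: measurable_funTS.
have UA A : measurable A -> U A = mu (A `&` `]0%R, 1%R[).
  move=> mA; transitivity (\int[U]_x (\1_A x)%:E)%E.
    by rewrite integral_indic// setIT.
  rewrite UE ?integral_indic//.
  exact/measurable_EFinP/measurable_indic.
transitivity (\int[pushforward U q]_x h x)%E.
  rewrite ge0_integral_pushforward//= UE//=; last exact: measurableT_comp.
  by apply: eq_integral => u u01; rewrite /q patchE u01.
rewrite -[RHS](ge0_integral_distribution X mh h0).
apply: eq_measure_integral => A mA _; apply: eq_measure_rays => //.
  by rewrite /= /pushforward preimage_setT probability_setT ltry.
move=> x; rewrite [RHS]ccdf_1_cdf.
have Fx : cdf X x = (fine (cdf X x))%:E by rewrite fineK ?fin_num_measure.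
rewrite Fx -EFinB -lebesgue_measure_setI01; last first.
  by rewrite -!lee_fin -Fx cdf_ge0 cdf_le1.
have mqx : measurable (q @^-1` `]x, +oo[).
  by rewrite -[X in measurable X]setTI; exact: mq.
rewrite -[LHS]/(U (q @^-1` `]x, +oo[)) UA//; congr (mu _).
apply/seteqP; split => u /=.
  move=> [+ u01]; rewrite /q patchE mem_set// !in_itv/= !andbT.
  by rewrite quantile_gt// Fx lte_fin.
move=> [+ u01]; rewrite /q patchE mem_set// !in_itv/= !andbT => Fu.
by rewrite quantile_gt// Fx lte_fin.
Qed.

(** Both sides are by definition differences of the integrals of the positive
    and negative parts, and these agree one by one. *)
Lemma integral_quantile :
  (\int[mu]_(u in `]0%R, 1%R[) (quantile X u)%:E = 'E_P[X])%E.
Proof.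
transitivity (\int[P]_w (EFin \o X) w)%E; last by rewrite expectation_def.
rewrite -[LHS]/(\int[mu]_(u in `]0%R, 1%R[) (EFin \o quantile X) u)%E.
rewrite [LHS]integralE [RHS]integralE.
rewrite (funepos_comp EFin (quantile X)) (funepos_comp EFin X).
rewrite (funeneg_comp EFin (quantile X)) (funeneg_comp EFin X).
have mE : measurable_fun setT (EFin : R -> \bar R) by exact/measurable_EFinP.
congr (_ - _)%E.
- apply: ge0_integral_quantile => //.
  exact: measurable_funepos.
- apply: ge0_integral_quantile => //.
  exact: measurable_funeneg.
Qed.

Lemma integrable_quantile : P.-integrable setT (EFin \o X) ->
  mu.-integrable `]0%R, 1%R[ (EFin \o quantile X).
Proof.
move=> /integrableP[_ Xoo]; apply/integrableP; split.
  by apply/measurable_EFinP; exact: measurable_quantile.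
rewrite (ge0_integral_quantile (h := fun x => `|x%:E|%E))//.
exact: measurableT_comp.
Qed.

End quantile_transform.

(** * Finite expectations *)

(** The convention (+oo) - (+oo) = -oo makes an expectation infinite as soon as
    the positive or the negative part is not integrable. *)
Lemma expectation_fin_num_integrable d (T : measurableType d) (R : realType)
    (P : probability T R) (X : {RV P >-> R}) :
  'E_P[X]%E \is a fin_num -> P.-integrable setT (EFin \o X).
Proof.
rewrite expectation_def integralE fin_numB => /andP[Xp Xn].
have mX : measurable_fun setT (EFin \o X) by exact/measurable_EFinP.
apply/integrableP; split => //.
rewrite -/(abse \o (EFin \o X)) fune_abse ge0_integralD//.
- by rewrite ltey_eq fin_numD Xp Xn.
- exact: measurable_funepos.
- exact: measurable_funeneg.
Qed.

(** * Random variables with a given density *)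

Section density.
Local Open Scope ereal_scope.
Context d (T : measurableType d) (R : realType)
  (mu : {measure set T -> \bar R}) (f : T -> R).

(** The hypotheses on [f] are arguments, so that the probability structure
    declared below can be inferred from the term alone. *)
Definition density_prob (mf : measurable_fun setT f)
    (f0 : forall x, (0 <= f x)%R) (f1 : \int[mu]_x (f x)%:E = 1) :
    set T -> \bar R :=
  fun A => \int[mu]_(x in A) (f x)%:E.

Context (mf : measurable_fun setT f) (f0 : forall x, (0 <= f x)%R)
  (f1 : \int[mu]_x (f x)%:E = 1).

Local Notation nu := (density_prob mf f0 f1).

Let nu0 : nu set0 = 0. Proof. exact: integral_set0. Qed.

Let nu_ge0 A : 0 <= nu A.
Proof. by apply: integral_ge0 => x _; rewrite lee_fin. Qed.

Let nu_sigma_additive : semi_sigma_additive nu.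
Proof.
apply: semi_sigma_additive_nng_induced => [|x]; last by rewrite lee_fin.
exact/measurable_EFinP.
Qed.

HB.instance Definition _ := isMeasure.Build _ _ _ nu
  nu0 nu_ge0 nu_sigma_additive.

Let nuT : nu setT = 1. Proof. exact: f1. Qed.

HB.instance Definition _ := Measure_isProbability.Build _ _ _ nu nuT.

End density.

(** On the real line with the probability of density [f] extended by 0, the
    identity has density [f]. It has to be modified outside ]0, 1[, a set of
    probability zero, to take all its values in ]0, 1[. *)
Lemma pdf_in01_exists (R : realType) (f : R -> R) :
    measurable_fun `](0:R), 1[ f -> (forall u, 0 < u < 1 -> 0 <= f u) ->
    (\int[@lebesgue_measure R]_(u in `]0%R, 1%R[) (f u)%:E = 1)%E ->
  is_pdf_of_ac_rv_in01 f.
Proof.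
move=> mf f0 f1; pose g := f \_ `]0, 1[.
have mg : measurable_fun [set: R] g.
  exact: (measurable_restrictT f (measurable_itv `](0:R), 1[)).1.
have g0 x : 0 <= g x.
  by rewrite /g patchE; case: ifPn => //; rewrite inE/= in_itv/=; exact: f0.
have EFin_g : EFin \o g = (EFin \o f) \_ `]0, 1[.
  by apply/funext => x; rewrite /g /= !patchE; case: ifP.
have g1 : (\int[@lebesgue_measure R]_x (g x)%:E = 1)%E.
  by rewrite -f1 [RHS]integral_mkcond -EFin_g.
pose P : probability (measurableTypeR R) R :=
  @density_prob _ (measurableTypeR R) R (@lebesgue_measure R) g mg g0 g1.
pose Z0 (w : measurableTypeR R) : R := if 0 < (w : R) < 1 then w else 2^-1.
have mZ : measurable_fun setT Z0.
  apply: measurable_fun_if => //.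
  by apply: measurable_and; exact: measurable_fun_ltr.
pose Z : {mfun measurableTypeR R >-> R} :=
  HB.pack Z0 (isMeasurableFun.Build _ _ _ _ Z0 mZ).
have ZE A :
    distribution P Z A = (\int[@lebesgue_measure R]_(x in A) (g x)%:E)%E.
  (* Z0 is the identity where the density g is not 0 *)
  rewrite -[LHS]/(\int[@lebesgue_measure R]_(x in Z0 @^-1` A) (g x)%:E)%E.
  rewrite -/(EFin \o g) EFin_g -!integral_mkcondr.
  congr (integral _ _ _); apply/seteqP; split => x /=; rewrite in_itv/= /Z0;
    by case: ifP => // _ [].
exists _, (measurableTypeR R), P, Z; split.
- move=> w; rewrite /= /Z0; case: ifPn => // _.
  by rewrite invr_gt0 ltr0n invf_lt1 ?ltr0n// ltr1n.
- apply/null_content_dominatesP => A mA muA.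
  rewrite ZE; apply: null_set_integral => //.
  by apply/measurable_EFinP; exact: measurable_funTS.
- by split.
Qed.

(** * The stochastic order in terms of quantiles *)

(** If F_X(t) < F_Y(t), any u strictly between the two, such as the midpoint,
    satisfies Q_Y(u) <= t < Q_X(u). *)
Lemma st_leP (R : realType) (d1 d2 : measure_display)
    (T1 : measurableType d1) (T2 : measurableType d2)
    (P : probability T1 R) (Q : probability T2 R)
    (X : {RV P >-> R}) (Y : {RV Q >-> R}) :
  st_le X Y <-> forall u, 0 < u < 1 -> quantile X u <= quantile Y u.
Proof.
have cdf_st t : (ccdf X t <= ccdf Y t)%E = (cdf Y t <= cdf X t)%E.
  by rewrite !ccdf_1_cdf leeD2lE// leeN2.
split=> [XY u u01|qXY t].
  rewrite quantile_le// (@le_trans _ _ (cdf Y (quantile Y u)))//.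
    by rewrite -quantile_le.
  by rewrite -cdf_st.
rewrite cdf_st leNgt; apply/negP.
have fineFX : cdf X t = (fine (cdf X t))%:E by rewrite fineK ?fin_num_measure.
have fineFY : cdf Y t = (fine (cdf Y t))%:E by rewrite fineK ?fin_num_measure.
have := cdf_ge0 X t; have := cdf_le1 Y t; rewrite fineFX fineFY.
rewrite !lte_fin !lee_fin.
set v := fine (cdf X t); set w := fine (cdf Y t) => w1 v0 vw.
have [vu uw] := midf_lt vw; set u := (v + w) / 2 in vu uw.
have u01 : 0 < u < 1 by rewrite (le_lt_trans v0)// (lt_le_trans uw).
have : quantile X u <= t.
  by rewrite (le_trans (qXY u u01))// quantile_le// fineFY lee_fin ltW.
by rewrite quantile_le// fineFX lee_fin leNgt vu.
Qed.

Theorem proposition2 (R : realType) (d1 d2 : measure_display)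
    (T1 : measurableType d1) (T2 : measurableType d2)
    (P : probability T1 R) (Q : probability T2 R)
    (X : {RV P >-> R}) (Y : {RV Q >-> R})
    (hX : (-oo < 'E_P[X])%E)
    (hXY : ('E_P[X] < 'E_Q[Y])%E)
    (hY : ('E_Q[Y] < +oo)%E) :
  is_pdf_of_ac_rv_in01 (f_ZL X Y) <-> st_le X Y.
Proof.
have EX : 'E_P[X]%E \is a fin_num.
  by rewrite fin_numE gt_eqF//= lt_eqF// (lt_trans hXY).
have EY : 'E_Q[Y]%E \is a fin_num.
  by rewrite fin_numE (lt_eqF hY) andbT gt_eqF// (lt_trans hX).
have m0 : 0 < fine 'E_Q[Y] - fine 'E_P[X].
  by rewrite subr_gt0 -lte_fin !fineK.
have iX := integrable_quantile (expectation_fin_num_integrable EX).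
have iY := integrable_quantile (expectation_fin_num_integrable EY).
rewrite st_leP; split.
  move=> [d [T [M [Z [_ _ [_ f0 _]]]]]] u u01.
  have := f0 u; rewrite patchE mem_set/= ?in_itv//.
  by rewrite /f_ZL pmulr_lge0 ?invr_gt0// subr_ge0.
move=> qXY; apply: pdf_in01_exists.
- apply: measurable_funM => //.
  by apply: measurable_funB; exact: measurable_quantile.
- by move=> u u01; rewrite divr_ge0 ?subr_ge0 ?qXY// -subr_ge0 ltW.
under eq_integral do rewrite /f_ZL EFinM EFinB.
rewrite integralZr//; last exact: integrableB.
rewrite integralB// !integral_quantile -(fineK EX) -(fineK EY) -EFinB -EFinM /=.
by rewrite divff// gt_eqF.
Qed.
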